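(* Let $A \in \mathbb{R}^{n\times n}$, let $\boldsymbol{x} \in \mathbb{R}^n$ be a left eigenvector of $A$, i.e. $\boldsymbol{x} \neq \boldsymbol{0}$ and $\boldsymbol{x}^T A = \lambda \boldsymbol{x}^T$, and let $Q \in \mathbb{R}^{n\times(n-1)}$ be a matrix whose columns form an orthonormal basis of $\operatorname{span}\{\boldsymbol{x}\}^{\perp}$. Let $\boldsymbol{b} \in \mathbb{R}^n$, $\boldsymbol{b}\neq \boldsymbol{0}$, with $\boldsymbol{b} \perp \boldsymbol{x}$. Let $(\xi_j)_{j\ge 1}$ be a sequence of poles in $(\mathbb{R}\cup\{\infty\})\setminus(\sigma(A)\cup\{0\})$, and let $k \ge 1$ be at most the invariance index of the sequence of rational Krylov subspaces $\mathcal{Q}_j(A,\boldsymbol{b})$, $j \ge 1$. Let $V_k = [\boldsymbol{v}_1 \,\cdots\, \boldsymbol{v}_k] \in \mathbb{R}^{n\times k}$ have orthonormal columns with $\boldsymbol{v}_1 = \boldsymbol{b}/\|\boldsymbol{b}\|_2$ and $\operatorname{span}\{\boldsymbol{v}_1,\dots,\boldsymbol{v}_j\} = \mathcal{Q}_j(A,\boldsymbol{b})$ for $j=1,\dots,k$, and let $U_k = [\boldsymbol{u}_1\,\cdots\,\boldsymbol{u}_k] \in \mathbb{R}^{(n-1)\times k}$ have orthonormal columns with $\boldsymbol{u}_1 = Q^T\boldsymbol{b}/\|Q^T\boldsymbol{b}\|_2$ and $\operatorname{span}\{\boldsymbol{u}_1,\dots,\boldsymbol{u}_j\} = \mathcal{Q}_j(Q^TAQ,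 Q^T\boldsymbol{b})$ for $j=1,\dots,k$ (with the same poles $\xi_j$). Set $B_k = V_k^T A V_k$ and $C_k = U_k^T (Q^T A Q) U_k$, and let $f$ be a function defined on the spectra of $A$, $B_k$ and $C_k$. Define $$\bar{\boldsymbol{y}}_k = V_k f(B_k) V_k^T \boldsymbol{b}, \qquad \bar{\bar{\boldsymbol{y}}}_k = Q U_k f(C_k) U_k^T Q^T \boldsymbol{b}.$$ Then (in exact arithmetic) $\bar{\boldsymbol{y}}_k = \bar{\bar{\boldsymbol{y}}}_k$.
   Context: For a square matrix $M$, a vector $\boldsymbol{c}$ and poles $\xi_1,\xi_2,\dots$, nonzero and not in $\sigma(M)$ (possibly $\infty$), the rational Krylov subspace of order $k$ is $$\mathcal{Q}_k(M,\boldsymbol{c}) = q_{k-1}(M)^{-1}\operatorname{span}\{\boldsymbol{c}, M\boldsymbol{c},\dots,M^{k-1}\boldsymbol{c}\}, \qquad q_{k-1}(z)=\prod_{j=1}^{k-1}(1-z/\xi_j),$$ where a factor with $\xi_j=\infty$ equals $1$. These subspaces are nested, and the invariance index $K$ is the smallest index such that $\mathcal{Q}_K(M,\boldsymbol{c})=\mathcal{Q}_{K+j}(M,\boldsymbol{c})$ for all $j\ge 0$; for $k\le K$ one has $\dim\mathcal{Q}_k(M,\boldsymbol{c})=k$. The bases $V_k$ and $U_k$ are those produced by the rational Arnoldi algorithm (successive orthonormalization). A function $f$ is defined on the spectrum of a matrix $M$ if the values $f^{(j)}(\mu)$ exist for every eigenvalue $\mu$ of $M$ and every $j=0,\dots,m-1$,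 where $m$ ranges over the sizes of the Jordan blocks of $M$ associated with $\mu$; then $f(M)$ is defined through the Jordan canonical form in the usual way (primary matrix function). *)

(* Defs.v *)
From HB Require Import structures.
From mathcomp Require Import all_boot all_order all_algebra complex.
From mathcomp Require Import all_classical all_reals all_analysis.

Set Implicit Arguments.
Unset Strict Implicit.
Unset Printing Implicit Defensive.

Import Order.TTheory GRing.Theory Num.Theory.
Import numFieldNormedType.Exports.

Local Open Scope classical_set_scope.
Local Open Scope ring_scope.

Definition norm2 (R : rcfType) (n : nat) (v : 'cV[R]_n) : R :=
  Num.sqrt (\sum_(i < n) v i 0 ^+ 2).

Definition orthonormal_cols (R : pzRingType) (n k : nat) (V : 'M[R]_(n, k)) : Prop :=
  V^T *m V = 1%:M.

Definition span_first_cols (F : fieldType) (n k : nat) (V : 'M[F]_(n, k)) (j : nat) :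
  {vspace 'cV[F]_n} :=
  <<[seq col i V | i : 'I_k <- enum 'I_k & (i < j)%N]>>%VS.

(* The columns of Q form an orthonormal basis of span{x}^perp. *)
Definition orthonormal_basis_orthocompl (F : fieldType) (n p : nat)
    (Q : 'M[F]_(n, p)) (x : 'cV[F]_n) : Prop :=
  orthonormal_cols Q /\
  forall v : 'cV[F]_n, (v \in span_first_cols Q p) = (x^T *m v == 0).

(** * Rational Krylov subspaces *)

(* Poles live in F \cup {oo}, with [None] standing for oo.  Pole sequences are
   indexed from 1: the value [xi 0] is never used. *)
Definition pole_factor (F : fieldType) (n : nat) (M : 'M[F]_n) (xi : option F) :
  'M[F]_n :=
  if xi is Some r then 1%:M - r^-1 *: M else 1%:M.

Definition admissible_poles (F : fieldType) (n : nat) (M : 'M[F]_n)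
    (xi : nat -> option F) : Prop :=
  forall (j : nat) (r : F), (0 < j)%N -> xi j = Some r ->
    r != 0 /\ ~~ eigenvalue M r.

(* q_{k-1}(M) *)
Definition krylov_denom (F : fieldType) (n : nat) (M : 'M[F]_n)
    (xi : nat -> option F) (k : nat) : 'M[F]_n :=
  \prod_(1 <= j < k) pole_factor M (xi j).

Definition rat_krylov (F : fieldType) (n : nat) (M : 'M[F]_n) (c : 'cV[F]_n)
    (xi : nat -> option F) (k : nat) : {vspace 'cV[F]_n} :=
  (linfun (mulmx (invmx (krylov_denom M xi k)))
     @: <<[seq M ^+ i *m c | i <- iota 0 k]>>)%VS.

Definition is_invariance_index (F : fieldType) (n : nat) (M : 'M[F]_n)
    (c : 'cV[F]_n) (xi : nat -> option F) (K : nat) : Prop :=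
  let stationary k := forall j : nat,
    rat_krylov M c xi k = rat_krylov M c xi (k + j) in
  [/\ (0 < K)%N, stationary K
    & forall k : nat, (0 < k)%N -> stationary k -> (K <= k)%N].

(** * Derivatives of a partial function *)

(* A scalar function is a pair of a domain D and a map f, whose values outside
   D are irrelevant.  Derivatives are limits of difference quotients taken
   within D: an open D gives complex derivatives, and D the real axis gives
   those of a function of a real variable. *)
Definition diffq (C : numFieldType) (g : C -> C) (z w : C) : C :=
  (g w - g z) / (w - z).

Fixpoint deriv_within (C : numFieldType) (D : set C) (f : C -> C) (j : nat) (z : C) : C :=
  if j is j'.+1 then lim (diffq (deriv_within D f j') z @ within D z^') else f z.

(* The value of the j-th derivative of (D, f) at z exists.  Being a limit point
   of D is required because otherwise every number is a limit at z. *)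
Fixpoint has_deriv_within (C : numFieldType) (D : set C) (f : C -> C) (j : nat) (z : C) :
  Prop :=
  if j is j'.+1 then
    [/\ D z, limit_point D z,
        \forall w \near z, D w -> has_deriv_within D f j' w
      & cvg (diffq (deriv_within D f j') z @ within D z^')]
  else D z.

(** * Primary matrix functions *)

Definition jordan_block (F : pzRingType) (mu : F) (m : nat) : 'M[F]_m :=
  \matrix_(i, j) (mu *+ (i == j) + (i.+1 == j)%:R).

Definition jordan_block_fun (C : numFieldType) (D : set C) (f : C -> C)
    (mu : C) (m : nat) : 'M[C]_m :=
  \matrix_(i, j)
    (if (i <= j)%N then deriv_within D f (j - i) mu / ((j - i)`!)%:R else 0).

(* M = P J P^-1 with J a direct sum of Jordan blocks.  The transition matrix
   and its inverse are rectangular because the size n of M is equal, but not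
   convertible, to the sum of the block sizes. *)
Record jordan_form (F : fieldType) (n : nat) (M : 'M[F]_n) := JordanForm {
  jf_nblocks : nat;
  jf_size : 'I_jf_nblocks -> nat;
  jf_eigval : 'I_jf_nblocks -> F;
  jf_P : 'M[F]_(n, \sum_i jf_size i);
  jf_Pinv : 'M[F]_(\sum_i jf_size i, n);
  jf_size_gt0 : forall i, (0 < jf_size i)%N;
  jf_PK : jf_P *m jf_Pinv = 1%:M;
  jf_PinvK : jf_Pinv *m jf_P = 1%:M;
  jf_eq : M = jf_P *m (\mxdiag_i jordan_block (jf_eigval i) (jf_size i)) *m jf_Pinv
}.

Definition defined_on_spectrum (C : numClosedFieldType) (n : nat) (D : set C)
    (f : C -> C) (M : 'M[C]_n) : Prop :=
  forall (J : jordan_form M) (i : 'I_(jf_nblocks J)) (j : nat),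
    (j < jf_size i)%N -> has_deriv_within D f j (jf_eigval i).

Definition jordan_fun (C : numClosedFieldType) (n : nat) (D : set C) (f : C -> C)
    (M : 'M[C]_n) (J : jordan_form M) : 'M[C]_n :=
  jf_P J *m (\mxdiag_i jordan_block_fun D f (jf_eigval i) (jf_size i)) *m jf_Pinv J.

(* f(M): the common value of jordan_fun D f J over all Jordan forms J of M.
   Every matrix over an algebraically closed field has a Jordan form, so the
   default value 0 is never taken. *)
Definition matfun (C : numClosedFieldType) (n : nat) (D : set C) (f : C -> C)
    (M : 'M[C]_n) : 'M[C]_n :=
  xget 0 (range (@jordan_fun C n D f M)).

Definition cplx_mx (R : rcfType) (m n : nat) (M : 'M[R]_(m, n)) : 'M[R[i]]_(m, n) :=
  map_mx (real_complex R) M.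

(* Main.v *)
Require Import Defs.
From HB Require Import structures.
From mathcomp Require Import all_boot all_order all_algebra complex.
From mathcomp Require Import all_classical all_reals all_analysis.

(** The columns of [Q] span the [A]-invariant hyperplane orthogonal to [x], so
    with [A' = Q^T A Q] and [b = Q b'] one has [A Q = Q A'].  Polynomials in
    the matrices, and inverses of them, are intertwined by [Q] as well, hence
    [Q] maps the rational Krylov spaces of [(A', b')] onto those of [(A, b)]
    ([rat_krylov_intertwine]).

    Consequently [V] and [Q U] are two orthonormal bases of the same space, and
    [V = Q U S] with [S] orthogonal ([orthonormal_same_range]).
    Then [V^T A V = S^T C S] where [C = U^T A' U],
    and since primary matrix functions commute with similarity
    ([matfun_similar]), the products [S S^T = 1] cancel in
    [V f(S^T C S) V^T b = Q U S S^T f(C) S S^T U^T Q^T b].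

    For [matfun_similar] the point is that [f(M)] does not depend on the chosen
    Jordan form.  More generally, if [M T = T N] then [f(M) T = T f(N)] whatever
    the Jordan forms used ([jordan_fun_intertwine]).  In Jordan coordinates
    this is a statement about each block of [T] separately: if the two
    eigenvalues differ the block vanishes, and if they agree both sides are
    the same polynomial in the nilpotent parts, which the block intertwines. *)

Set Implicit Arguments.
Unset Strict Implicit.
Unset Printing Implicit Defensive.

Import Order.TTheory GRing.Theory Num.Theory.
Import numFieldNormedType.Exports.

Local Open Scope classical_set_scope.
Local Open Scope ring_scope.

(** * Intertwined matrices *)

Lemma intertwineX (R : pzRingType) (n m : nat) (M : 'M[R]_n) (N : 'M[R]_m)
    (T : 'M[R]_(n, m)) (l : nat) :
  M *m T = T *m N -> M ^+ l *m T = T *m N ^+ l.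
Proof.
move=> MT; elim: l => [|l IHl]; first by rewrite !expr0 mul1mx mulmx1.
by rewrite !exprS -!mulmxE -mulmxA IHl mulmxA MT mulmxA.
Qed.

Lemma intertwine_inv (F : fieldType) (n m : nat) (M : 'M[F]_n) (N : 'M[F]_m)
    (T : 'M[F]_(n, m)) :
  M \in unitmx -> N \in unitmx -> M *m T = T *m N ->
  invmx M *m T = T *m invmx N.
Proof.
move=> uM uN MT.
by rewrite -[in LHS](mulmxK uN T) -MT -mulmxA mulKmx.
Qed.

(** * Primary matrix functions *)

Lemma jordan_blockE (R : pzRingType) (mu : R) (m : nat) :
  jordan_block mu m = mu%:M + jordan_block 0 m.
Proof. by apply/matrixP => i j; rewrite !mxE mul0rn add0r. Qed.

Lemma jordan_block0X (R : pzRingType) (m l : nat) (i j : 'I_m) :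
  (jordan_block (0 : R) m ^+ l) i j = (i + l == j :> nat)%N%:R.
Proof.
elim: l i j => [|l IHl] i j; first by rewrite expr0 mxE addn0.
rewrite exprS -mulmxE mxE.
under eq_bigr do rewrite IHl mxE mul0rn add0r.
have [lti|gei] := ltnP i.+1 m.
  rewrite (bigD1 (Ordinal lti)) //= eqxx mul1r big1 ?addr0 ?addnS //.
  by move=> c /negbTE; rewrite -val_eqE /= eq_sym => ->; rewrite mul0r.
rewrite big1 => [|c _]; last by rewrite gtn_eqF ?mul0r // (leq_trans _ gei).
by rewrite gtn_eqF // (leq_trans (ltn_ord j)) // addnS (leq_trans gei) //
  ltnS leq_addr.
Qed.

(** The Taylor sum may be taken arbitrarily long, because the nilpotent part
    kills the extra terms; this lets blocks of different sizes share the same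
    polynomial. *)
Lemma jordan_block_funE (C : numFieldType) (D : set C) (f : C -> C) (mu : C)
    (m N : nat) : (m <= N)%N ->
  jordan_block_fun D f mu m =
  \sum_(l < N) (deriv_within D f l mu / (l`!)%:R) *: jordan_block 0 m ^+ l.
Proof.
move=> mN; apply/matrixP => i j; rewrite mxE summxE.
under eq_bigr do rewrite mxE jordan_block0X.
case: leqP => [ij|ji].
  have ltN : (j - i < N)%N by rewrite (leq_ltn_trans (leq_subr _ _)) ?(leq_trans _ mN).
  rewrite (bigD1 (Ordinal ltN)) //= subnKC // eqxx mulr1 big1 ?addr0 //.
  move=> l; rewrite -val_eqE /= => /negbTE nl.
  by rewrite -[X in _ == X](subnKC ij) eqn_add2l nl mulr0.
by rewrite big1 // => l _; rewrite gtn_eqF ?mulr0 // (leq_trans ji) ?leq_addr.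
Qed.

Lemma jordan_block_unit (F : fieldType) (mu : F) (m : nat) :
  mu != 0 -> jordan_block mu m \in unitmx.
Proof.
move=> mu0; rewrite -unitmx_tr unitmxE det_trig.
  apply/rpred_prod => i _; rewrite !mxE eqxx mulr1n.
  by rewrite gtn_eqF // addr0 unitfE.
apply/is_trig_mxP => i j ij.
by rewrite !mxE -val_eqE !gtn_eqF ?mulr0n ?addr0 // ltnW // ltnS.
Qed.

(** Distinct eigenvalues force [T = 0]: [T] intertwines an invertible matrix
    with a nilpotent one. *)
Lemma jordan_block_intertwine_neq (F : fieldType) (mu nu : F) (p q : nat)
    (T : 'M[F]_(p, q)) : mu != nu ->
  jordan_block mu p *m T = T *m jordan_block nu q -> T = 0.
Proof.
move=> neq; rewrite !(jordan_blockE mu) (jordan_blockE nu) => JT.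
have /(intertwineX q) : jordan_block (mu - nu) p *m T = T *m jordan_block 0 q.
  apply: (addrI (nu *: T)); rewrite -mul_scalar_mx -mulmxDl jordan_blockE addrA.
  rewrite -raddfD /= [nu + _]addrC subrK JT mulmxDr.
  by rewrite mul_mx_scalar mul_scalar_mx.
have -> : jordan_block (0 : F) q ^+ q = 0.
  apply/matrixP => i j; rewrite jordan_block0X mxE gtn_eqF //.
  by rewrite (leq_trans (ltn_ord j)) ?leq_addl.
have uJ : jordan_block (mu - nu) p ^+ q \in unitmx.
  elim: q {T JT} => [|q IHq]; first by rewrite expr0 unitmx1.
  by rewrite exprS -mulmxE unitmx_mul IHq jordan_block_unit ?subr_eq0.
by rewrite mulmx0 => /(congr1 (mulmx (invmx (jordan_block (mu - nu) p ^+ q))));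
  rewrite mulKmx // mulmx0.
Qed.

Lemma jordan_block_fun_intertwine (C : numFieldType) (D : set C) (f : C -> C)
    (mu nu : C) (p q : nat) (T : 'M[C]_(p, q)) :
  jordan_block mu p *m T = T *m jordan_block nu q ->
  jordan_block_fun D f mu p *m T = T *m jordan_block_fun D f nu q.
Proof.
have [<-|neq /(jordan_block_intertwine_neq neq) ->] := eqVneq mu nu; last first.
  by rewrite mulmx0 mul0mx.
rewrite !(jordan_blockE mu) mulmxDl mulmxDr mul_scalar_mx mul_mx_scalar.
move=> /addrI NT.
rewrite (jordan_block_funE D f mu (leq_maxl p q)).
rewrite (jordan_block_funE D f mu (leq_maxr p q)).
rewrite mulmx_suml mulmx_sumr; apply: eq_bigr => l _.
by rewrite -scalemxAl -scalemxAr (intertwineX _ NT).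
Qed.

(** Changing to Jordan coordinates turns [T] into a block matrix whose
    [(i, j)] block intertwines the [i]-th block of [J] with the [j]-th block of
    [J'], because block diagonal matrices act blockwise. *)
Lemma jordan_fun_intertwine (C : numClosedFieldType) (n m : nat) (D : set C)
    (f : C -> C) (M : 'M[C]_n) (N : 'M[C]_m) (J : jordan_form M)
    (J' : jordan_form N) (T : 'M[C]_(n, m)) :
  M *m T = T *m N -> jordan_fun D f J *m T = T *m jordan_fun D f J'.
Proof.
move=> MT; rewrite /jordan_fun.
set T' := jf_Pinv J *m T *m jf_P J'.
have eqT : T = jf_P J *m T' *m jf_Pinv J'.
  by rewrite /T' -!mulmxA jf_PK mulmx1 mulmxA jf_PK mul1mx.
have JT' : (\mxdiag_i jordan_block (jf_eigval i) (jf_size i)) *m T' =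
       T' *m (\mxdiag_i jordan_block (jf_eigval i) (jf_size i)).
  move: MT; rewrite [in LHS](jf_eq J) [in RHS](jf_eq J').
  move=> /(congr1 (fun Z => jf_Pinv J *m Z *m jf_P J')).
  by rewrite !mulmxA jf_PinvK mul1mx -!mulmxA jf_PinvK mulmx1 /T' !mulmxA.
clearbody T'; rewrite {}eqT {MT T}.
suff fT' : (\mxdiag_i jordan_block_fun D f (jf_eigval i) (jf_size i)) *m T' =
       T' *m (\mxdiag_i jordan_block_fun D f (jf_eigval i) (jf_size i)).
  rewrite !mulmxA -[_ *m jf_Pinv J *m jf_P J]mulmxA jf_PinvK mulmx1.
  rewrite -[_ *m jf_Pinv J' *m jf_P J']mulmxA jf_PinvK mulmx1.
  by rewrite -[jf_P J *m _ *m T']mulmxA fT' !mulmxA.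
move: JT'; rewrite -(submxblockK T') !mul_mxdiag_mxblock !mul_mxblock_mxdiag.
move=> /eq_mxblockP JT'; apply/eq_mxblockP => i j.
exact: jordan_block_fun_intertwine.
Qed.

Lemma matfunE (C : numClosedFieldType) (n : nat) (D : set C) (f : C -> C)
    (M : 'M[C]_n) (J : jordan_form M) : matfun D f M = jordan_fun D f J.
Proof.
apply: xget_unique; first by exists J.
move=> _ [J' _ <-].
by have := @jordan_fun_intertwine _ _ _ D f _ _ J' J 1%:M;
  rewrite !mulmx1 !mul1mx => /(_ erefl).
Qed.

Lemma jordan_form_similar (F : fieldType) (n : nat) (S S' M : 'M[F]_n) :
  S *m S' = 1%:M -> jordan_form M -> jordan_form (S' *m M *m S).
Proof.
move=> SS' J.
have S'S : S' *m S = 1%:M by exact: mulmx1C.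
apply: (@JordanForm _ _ _ _ (@jf_size _ _ _ J) (@jf_eigval _ _ _ J)
  (S' *m jf_P J) (jf_Pinv J *m S)).
- exact: jf_size_gt0.
- by rewrite -mulmxA [jf_P J *m _]mulmxA jf_PK mul1mx.
- by rewrite -mulmxA [S *m _]mulmxA SS' mul1mx jf_PinvK.
- by rewrite [in LHS](jf_eq J) !mulmxA.
Qed.

(** A Jordan form transports along a similarity in both directions, so that
    [matfun] takes its default value on both sides or on neither. *)
Lemma matfun_similar (C : numClosedFieldType) (n : nat) (D : set C)
    (f : C -> C) (S S' M : 'M[C]_n) : S *m S' = 1%:M ->
  matfun D f (S' *m M *m S) = S' *m matfun D f M *m S.
Proof.
move=> SS'; have S'S : S' *m S = 1%:M by exact: mulmx1C.
have [[J _]|noJ] := pselect (exists J : jordan_form M, True).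
  rewrite (matfunE D f J) (matfunE D f (jordan_form_similar SS' J)).
  rewrite -(jordan_fun_intertwine D f (jordan_form_similar SS' J)).
    by rewrite -[RHS]mulmxA S'S mulmx1.
  by rewrite -[LHS]mulmxA SS' mulmx1.
rewrite /matfun !xgetPN ?mulmx0 ?mul0mx //; move=> _ [J _ _]; apply: noJ.
  by exists J.
have := jordan_form_similar S'S J.
by rewrite !mulmxA SS' mul1mx -mulmxA SS' mulmx1 => J'; exists J'.
Qed.

(** * Rational Krylov spaces *)

Lemma span_first_colsP (F : fieldType) (n k : nat) (V : 'M[F]_(n, k))
    (v : 'cV[F]_n) :
  v \in span_first_cols V k <-> exists w, v = V *m w.
Proof.
rewrite /span_first_cols.
have -> : [seq i : 'I_k <- enum 'I_k | (i < k)%N] = enum 'I_k.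
  by apply/all_filterP/allP => i _; exact: ltn_ord.
have mulE (w : 'cV[F]_k) : V *m w = \sum_i w i 0 *: col i V.
  by apply/matrixP => i j; rewrite ord1 !mxE summxE; apply: eq_bigr => l _;
    rewrite !mxE mulrC.
split=> [|[w ->]]; last first.
  rewrite mulE; apply: memv_suml => i _; apply: memvZ; apply: memv_span.
  by apply/map_f; rewrite mem_enum.
rewrite span_def big_map big_enum => /memv_sumP[u uP ->].
have /fin_all_exists[a aP] i : exists a, u i = a *: col i V.
  by have /vlineP[a ->] := uP i isT; exists a.
exists (\col_i a i); rewrite mulE; apply: eq_bigr => i _.
by rewrite mxE aP.
Qed.

Lemma pole_factor_unit (F : fieldType) (n : nat) (M : 'M[F]_n)
    (xi : nat -> option F) (j : nat) :
  admissible_poles M xi -> (0 < j)%N -> pole_factor M (xi j) \in unitmx.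
Proof.
move=> adm j0; rewrite /pole_factor; case E: (xi j) => [r|]; last exact: unitmx1.
have [r0] := adm j r j0 E.
rewrite /eigenvalue /eigenspace negbK kermx_eq0 row_free_unit => uM.
have -> : 1%:M - r^-1 *: M = - r^-1 *: (M - r%:M).
  by rewrite scalerBr scale_scalar_mx !scaleNr mulNr mulVf // raddfN opprK addrC.
by rewrite unitmxZ // unitfE oppr_eq0 invr_eq0.
Qed.

Lemma krylov_denom_unit (F : fieldType) (n : nat) (M : 'M[F]_n)
    (xi : nat -> option F) (k : nat) :
  admissible_poles M xi -> krylov_denom M xi k \in unitmx.
Proof.
move=> adm; rewrite /krylov_denom big_nat.
elim/big_ind: _ => [|X Y uX uY|j /andP[j0 _]]; first exact: unitmx1.
  by rewrite -mulmxE unitmx_mul uX uY.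
exact: pole_factor_unit.
Qed.

Lemma krylov_denom_intertwine (F : fieldType) (n m : nat) (M : 'M[F]_n)
    (N : 'M[F]_m) (T : 'M[F]_(n, m)) (xi : nat -> option F) (k : nat) :
  M *m T = T *m N -> krylov_denom M xi k *m T = T *m krylov_denom N xi k.
Proof.
move=> MT; rewrite /krylov_denom.
elim: (index_iota 1 k) => [|j s IHs]; first by rewrite !big_nil mul1mx mulmx1.
rewrite !big_cons -!mulmxE -mulmxA IHs !mulmxA; congr (_ *m _).
rewrite /pole_factor; case: (xi j) => [r|]; last by rewrite mul1mx mulmx1.
by rewrite mulmxBl mulmxBr mul1mx mulmx1 -scalemxAl -scalemxAr MT.
Qed.

(** The poles avoid the spectrum of [M] only, so invertibility for the
    compressed matrix [N] has to be inherited: since [q(M) T = T q(N)] and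
    [T' T = 1], the compression [T' q(M)^-1 T] is a left inverse of [q(N)]. *)
Lemma krylov_denom_unit_intertwine (F : fieldType) (n m : nat) (M : 'M[F]_n)
    (N : 'M[F]_m) (T : 'M[F]_(n, m)) (T' : 'M[F]_(m, n))
    (xi : nat -> option F) (k : nat) :
  T' *m T = 1%:M -> M *m T = T *m N -> admissible_poles M xi ->
  krylov_denom N xi k \in unitmx.
Proof.
move=> TK MT adm; have uM := krylov_denom_unit k adm.
have := krylov_denom_intertwine xi k MT.
move=> /(congr1 (fun Z => T' *m (invmx (krylov_denom M xi k) *m Z))).
rewrite mulKmx // TK !mulmxA => /esym/mulmx1_unit[_ //].
Qed.

Lemma rat_krylov_intertwine (F : fieldType) (n m : nat) (M : 'M[F]_n)
    (N : 'M[F]_m) (T : 'M[F]_(n, m)) (T' : 'M[F]_(m, n)) (c : 'cV[F]_m)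
    (xi : nat -> option F) (k : nat) :
  T' *m T = 1%:M -> M *m T = T *m N -> admissible_poles M xi ->
  rat_krylov M (T *m c) xi k = (linfun (mulmx T) @: rat_krylov N c xi k)%VS.
Proof.
move=> TK MT adm; rewrite /rat_krylov !limg_span -!map_comp; congr (span _).
apply: eq_map => i /=; rewrite !lfunE /= !mulmxA.
have uN := krylov_denom_unit_intertwine k TK MT adm.
have uM := krylov_denom_unit k adm.
rewrite -(intertwine_inv uM uN (krylov_denom_intertwine xi k MT)).
by rewrite -[_ *m M ^+ i *m T]mulmxA (intertwineX i MT) !mulmxA.
Qed.

(** * Orthonormal bases *)

Lemma col_matrixP (R : Type) (n m : nat) (X Y : 'M[R]_(n, m)) :
  (forall j, col j X = col j Y) -> X = Y.
Proof.
by move=> XY; apply/matrixP => i j; have /colP/(_ i) := XY j; rewrite !mxE.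
Qed.

Lemma col_mulmx (R : pzRingType) (n m p : nat) (X : 'M[R]_(n, m))
    (Y : 'M[R]_(m, p)) (j : 'I_p) : col j (X *m Y) = X *m col j Y.
Proof. by rewrite !colE mulmxA. Qed.

(** The change of basis is the matrix [W^T V] of inner products, since
    [W W^T] is the identity on the range of [W]. *)
Lemma orthonormal_same_range (F : fieldType) (n k : nat) (V W : 'M[F]_(n, k)) :
  orthonormal_cols V -> orthonormal_cols W ->
  (forall v, v \in span_first_cols V k -> exists w, v = W *m w) ->
  exists S : 'M[F]_k, V = W *m S /\ S *m S^T = 1%:M.
Proof.
move=> VV WW VW.
have VE : V = W *m (W^T *m V).
  apply: col_matrixP => j.
  have [|w wE] := VW (col j V).
    by apply/span_first_colsP; exists (delta_mx j 0); rewrite colE.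
  by rewrite !col_mulmx wE [W^T *m _]mulmxA WW mul1mx.
exists (W^T *m V); split=> //; apply: mulmx1C.
by rewrite trmx_mul trmxK -mulmxA -VE.
Qed.

(** [Q Q^T] is the orthogonal projection onto the hyperplane orthogonal to
    [x], which contains the columns of [B]. *)
Lemma orthocompl_projection (F : fieldType) (n p : nat) (Q : 'M[F]_(n, p))
    (x : 'cV[F]_n) (m : nat) (B : 'M[F]_(n, m)) :
  orthonormal_basis_orthocompl Q x -> x^T *m B = 0 -> Q *m (Q^T *m B) = B.
Proof.
move=> [QQ Qx] xB; apply: col_matrixP => j; rewrite !col_mulmx.
have : col j B \in span_first_cols Q p by rewrite Qx -col_mulmx xB col0.
by move=> /span_first_colsP[w ->]; rewrite [Q^T *m _]mulmxA QQ mul1mx.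
Qed.

Lemma orthocompl_orth (F : fieldType) (n p : nat) (Q : 'M[F]_(n, p))
    (x : 'cV[F]_n) : orthonormal_basis_orthocompl Q x -> x^T *m Q = 0.
Proof.
move=> [_ Qx]; apply: col_matrixP => j; rewrite col_mulmx col0.
by apply/eqP; rewrite -Qx; apply/span_first_colsP; exists (delta_mx j 0);
  rewrite colE.
Qed.

(** * Equality of the two approximations *)

Theorem theorem5p4 (R : realType) (n : nat) (A : 'M[R]_n)
    (x : 'cV[R]_n) (lambda : R)
    (x_neq0 : x != 0) (x_eigen : x^T *m A = lambda *: x^T)
    (Q : 'M[R]_(n, n.-1)) (Q_basis : orthonormal_basis_orthocompl Q x)
    (b : 'cV[R]_n) (b_neq0 : b != 0) (b_orth : x^T *m b = 0)
    (xi : nat -> option R) (xi_poles : admissible_poles A xi)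
    (K : nat) (K_inv : is_invariance_index A b xi K)
    (k : nat) (k_gt0 : (0 < k)%N) (k_leK : (k <= K)%N)
    (V : 'M[R]_(n, k)) (V_orth : orthonormal_cols V)
    (V_first : col (Ordinal k_gt0) V = (norm2 b)^-1 *: b)
    (V_span : forall j : nat, (1 <= j <= k)%N ->
       span_first_cols V j = rat_krylov A b xi j)
    (U : 'M[R]_(n.-1, k)) (U_orth : orthonormal_cols U)
    (U_first : col (Ordinal k_gt0) U = (norm2 (Q^T *m b))^-1 *: (Q^T *m b))
    (U_span : forall j : nat, (1 <= j <= k)%N ->
       span_first_cols U j = rat_krylov (Q^T *m A *m Q) (Q^T *m b) xi j)
    (D : set R[i]) (f : R[i] -> R[i])
    (f_A : defined_on_spectrum D f (cplx_mx A))
    (f_B : defined_on_spectrum D f (cplx_mx (V^T *m A *m V)))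
    (f_C : defined_on_spectrum D f (cplx_mx (U^T *m (Q^T *m A *m Q) *m U))) :
  cplx_mx V *m matfun D f (cplx_mx (V^T *m A *m V))
    *m cplx_mx V^T *m cplx_mx b =
  cplx_mx Q *m cplx_mx U *m matfun D f (cplx_mx (U^T *m (Q^T *m A *m Q) *m U))
    *m cplx_mx U^T *m cplx_mx Q^T *m cplx_mx b.
Proof.
have QQ : Q^T *m Q = 1%:M := Q_basis.1.
have Qb := orthocompl_projection Q_basis b_orth.
have AQ : A *m Q = Q *m (Q^T *m A *m Q).
  rewrite -mulmxA (orthocompl_projection Q_basis) //.
  by rewrite mulmxA x_eigen -scalemxAl (orthocompl_orth Q_basis) scaler0.
have kk : (1 <= k <= k)%N by rewrite k_gt0 leqnn.
have W_orth : orthonormal_cols (Q *m U).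
  by rewrite /orthonormal_cols trmx_mul mulmxA -[_ *m Q]mulmxA QQ mulmx1.
have [v|S [VE SS]] := orthonormal_same_range V_orth W_orth.
  rewrite (V_span k kk) -Qb (rat_krylov_intertwine _ _ QQ AQ xi_poles).
  rewrite -(U_span k kk) => /memv_imgP[u /span_first_colsP[w ->] ->].
  by exists w; rewrite lfunE /= mulmxA.
have cM (p q r : nat) (X : 'M[R]_(p, q)) (Y : 'M[R]_(q, r)) :
  cplx_mx (X *m Y) = cplx_mx X *m cplx_mx Y by exact: map_mxM.
have cSS : cplx_mx S *m cplx_mx S^T = 1%:M by rewrite -cM SS /cplx_mx map_mx1.
have -> : V^T *m A *m V = S^T *m (U^T *m (Q^T *m A *m Q) *m U) *m S.
  by rewrite VE !trmx_mul !mulmxA.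
rewrite !(cM _ _ _ (S^T *m _)) (cM _ _ _ S^T) (matfun_similar _ _ _ cSS).
rewrite VE !trmx_mul !cM !mulmxA.
rewrite -[_ *m cplx_mx S *m cplx_mx S^T]mulmxA cSS mulmx1.
by rewrite -[_ *m cplx_mx S *m cplx_mx S^T]mulmxA cSS mulmx1.
Qed.
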